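(* Let $K$ be a field with $\operatorname{char}K\ne 2$, and let $$\mathrm{perm}_3=\sum_{\sigma\in\Sigma_3}e_{\sigma(1)}\otimes e_{\sigma(2)}\otimes e_{\sigma(3)}\in K^3\otimes K^3\otimes K^3,$$ where $e_1,e_2,e_3$ is the standard basis of $K^3$ and $\Sigma_3$ is the symmetric group on $3$ letters. Then $\operatorname{brk}(\mathrm{perm}_3)=\operatorname{trk}(\mathrm{perm}_3)=4$.
   Context: The tensor rank $\operatorname{trk}(T)$ of $T\in K^a\otimes K^b\otimes K^c$ is the smallest $n$ such that $T$ is a sum of $n$ pure tensors $u\otimes v\otimes w$. Let $Z_n$ be the set of tensors of tensor rank $\le n$ and $\overline Z_n$ its Zariski closure (in the affine space $K^a\otimes K^b\otimes K^c$ over $K$). The border rank $\operatorname{brk}(T)$ is the smallest $n$ such that $T\in\overline Z_n$. *)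

(* Defs.v *)
From HB Require Import structures.
From mathcomp Require Import all_boot all_order all_fingroup all_algebra.
From mathcomp Require Import boolp classical_sets.
From mathcomp Require Import mpoly.

Set Implicit Arguments.
Unset Strict Implicit.
Unset Printing Implicit Defensive.

Import GRing.Theory.
Local Open Scope ring_scope.
Local Open Scope classical_set_scope.

(* K^a (x) K^b (x) K^c, by coordinates in the basis e_i (x) e_j (x) e_k. *)
Notation tensor_index a b c := ('I_a * 'I_b * 'I_c)%type.
Notation tensor K a b c := {ffun tensor_index a b c -> K}.

Section Tensors.

Variables (K : fieldType) (a b c : nat).
Implicit Types (T : tensor K a b c) (X Z : set (tensor K a b c)).

Definition pure (u : 'rV[K]_a) (v : 'rV[K]_b) (w : 'rV[K]_c) : tensor K a b c :=
  [ffun i => u 0 i.1.1 * v 0 i.1.2 * w 0 i.2].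

Definition rank_le (n : nat) : set (tensor K a b c) :=
  [set T | exists (u : 'I_n -> 'rV[K]_a) (v : 'I_n -> 'rV[K]_b)
                  (w : 'I_n -> 'rV[K]_c),
     T = \sum_(i < n) pure (u i) (v i) (w i)].

(* Polynomial functions on the space of tensors: the variable 'X_i stands for
   the coordinate function T |-> T (enum_val i). *)
Notation tensor_poly := {mpoly K[#|{: tensor_index a b c}|]}.

Definition tensor_eval (p : tensor_poly) T : K := p.@[fun i => T (enum_val i)].

Definition zariski_closed X : Prop :=
  exists I : set tensor_poly,
    X = [set T | forall p, I p -> tensor_eval p T = 0].

Definition zariski_closure Z : set (tensor K a b c) := smallest zariski_closed Z.

Definition border_rank_le (n : nat) : set (tensor K a b c) :=
  zariski_closure (rank_le n).

Lemma rank_le_full T : rank_le #|{: tensor_index a b c}| T.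
Proof.
exists (fun i => T (enum_val i) *: delta_mx 0 (enum_val i).1.1).
exists (fun i => delta_mx 0 (enum_val i).1.2).
exists (fun i => delta_mx 0 (enum_val i).2).
apply/ffunP => k; rewrite sum_ffunE (bigD1 (enum_rank k)) //= big1 => [|i ik].
  by rewrite ffunE !mxE enum_rankK !eqxx !mulr1 addr0.
rewrite ffunE !mxE /=; case: eqP => [e1|]; last by rewrite mulr0 !mul0r.
case: eqP => [e2|]; last by rewrite mulr0 mul0r.
case: eqP => [e3|]; last by rewrite mulr0.
case/eqP: ik; rewrite -(enum_valK i); congr enum_rank.
by case: (enum_val i) k e1 e2 e3 => [[? ?] ?] [[? ?] ?] /= -> -> ->.
Qed.

Lemma rank_le_border n : rank_le n `<=` border_rank_le n.
Proof. by move=> T ZT X [_]; exact. Qed.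

Lemma ex_rank_le T : exists n, `[< rank_le n T >].
Proof. by eexists; apply/asboolP; exact: rank_le_full. Qed.

Lemma ex_border_rank_le T : exists n, `[< border_rank_le n T >].
Proof.
by eexists; apply/asboolP; apply: rank_le_border; exact: rank_le_full.
Qed.

Definition trk T : nat := ex_minn (ex_rank_le T).

Definition brk T : nat := ex_minn (ex_border_rank_le T).

End Tensors.

(* Indices run over 'I_3 = {0, 1, 2}. *)
Definition perm3 (K : fieldType) : tensor K 3 3 3 :=
  \sum_(s : 'S_3)
    pure (delta_mx 0 (s 0)) (delta_mx 0 (s 1)) (delta_mx 0 (s 2%:R)).

(* Main.v *)
Require Import Defs.
From mathcomp Require Import all_boot all_fingroup all_algebra.
From mathcomp Require Import boolp classical_sets mpoly ring.
Local Open Scope ring_scope.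

Set Implicit Arguments.
Unset Strict Implicit.
Unset Printing Implicit Defensive.

Import GRing.Theory.

(** The upper bound is Glynn's formula: averaging
    d_1 d_2 (e_0 + d_1 e_1 + d_2 e_2)^(x)3 over the four choices of signs
    d_1, d_2 kills every monomial but those of perm3, because each sign must
    occur an odd number of times to survive; this writes perm3 as a sum of four
    pure tensors as soon as 4 is invertible ([perm3_rank_le4]).

    The lower bound is a Koszul flattening, which is Strassen's equation.  A
    tensor T in A (x) B (x) C with dim A = 3 gives a linear map
    A (x) B^* -> (wedge^2 A) (x) C, x (x) y |-> x wedge T(y).  Its matrix is
    linear in T, and for a pure tensor u (x) v (x) w it has rank at most 2,
    because u wedge u = 0.  Hence all the minors of order 7 vanish on tensors of
    rank at most 3 ([koszul_det_eq0]), and so do they on the Zariski closure.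
    For perm3 this 9 x 9 matrix has rank 8: a suitable submatrix of order 7 is
    diagonal with entries 1 and -1 ([perm3_koszul]), in every characteristic. *)

Lemma zariski_closure_eval (K : fieldType) (a b c : nat)
    (Z : set (tensor K a b c)) (p : {mpoly K[#|{: tensor_index a b c}|]}) T :
  (forall S, Z S -> tensor_eval p S = 0) ->
  zariski_closure Z T -> tensor_eval p T = 0.
Proof.
move=> pZ /(_ [set S | tensor_eval p S = 0]%classic); apply.
split=> [|S /pZ //]; exists [set p]%classic.
by apply/seteqP; split=> S /= => [pS q ->|/(_ p)]; [| apply].
Qed.

(** The Levi-Civita symbol of (a, q, r) up to a global sign, where q is the
    index that completes a and r to a permutation of 0, 1, 2.  In the ring
    structure of ['I_3] that index is - (a + r), and a + 1 is the cyclic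
    successor of a. *)
Definition levi_civita (R : pzRingType) (a r : 'I_3) : R :=
  (r == a + 1)%:R - (a == r + 1)%:R.

(** The matrix of x |-> x wedge u on a space of dimension 3, with the basis
    vectors e_p wedge e_q of the exterior square named by the missing index and
    oriented by the sign of [levi_civita]. *)
Definition wedge_mx (R : pzRingType) (u : 'rV[R]_3) : 'M[R]_3 :=
  \matrix_(a, r) (levi_civita R a r * u 0 (- (a + r))).

Lemma mulmx_wedge_mx (R : comPzRingType) (u : 'rV[R]_3) : u *m wedge_mx u = 0.
Proof.
have [x [y [z uE]]] : exists x y z, forall i, u 0 i = nth 0 [:: x; y; z] i.
  exists (u 0 0), (u 0 1), (u 0 2%:R) => i.
  by case: i => -[|[|[|//]]] i_lt3; congr (u 0 _); apply/val_inj.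
apply/rowP => r; rewrite !mxE !big_ord_recl big_ord0 !mxE /levi_civita !uE.
by case: r => -[|[|[|//]]] r_lt3 /=; ring.
Qed.

Lemma rank_wedge_mx (K : fieldType) (u : 'rV[K]_3) :
  (\rank (wedge_mx u) <= 2)%N.
Proof.
have [->|u_neq0] := eqVneq u 0.
  suff -> : wedge_mx 0 = 0 :> 'M[K]_3 by rewrite mxrank0.
  by apply/matrixP => a r; rewrite !mxE mulr0.
rewrite -ltnS ltn_neqAle rank_leq_row andbT.
apply: contra u_neq0 => wedge_free.
by rewrite -(mulmx_free_eq0 u wedge_free) mulmx_wedge_mx.
Qed.

Section Koszul.

Variables (b c m : nat) (f : 'I_m -> 'I_3 * 'I_b) (g : 'I_m -> 'I_3 * 'I_c).

(** The submatrix on the rows [f] and columns [g] of the Koszul flattening of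
    the tensor with coordinates [t].  Coordinates are taken in any ring so that
    [t] may be the family of the indeterminates. *)
Definition koszul_mx (R : pzRingType) (t : tensor_index 3 b c -> R) : 'M[R]_m :=
  \matrix_(i, j) (levi_civita R (f i).1 (g j).1 *
                  t (- ((f i).1 + (g j).1), (f i).2, (g j).2)).

Lemma koszul_mx_sum (K : fieldType) n (T : 'I_n -> tensor K 3 b c) :
  koszul_mx (\sum_(i < n) T i) = \sum_(i < n) koszul_mx (T i).
Proof.
apply/matrixP => i j; rewrite summxE mxE sum_ffunE mulr_sumr.
by apply: eq_bigr => k _; rewrite mxE.
Qed.

(** On a pure tensor the flattening is the Kronecker product of [wedge_mx u]
    with the matrix v^T w of rank one, so it factors through [wedge_mx u]. *)
Lemma rank_koszul_mx_pure (K : fieldType) (u : 'rV[K]_3) (v : 'rV[K]_b)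
    (w : 'rV[K]_c) :
  (\rank (koszul_mx (pure u v w)) <= 2)%N.
Proof.
pose P := \matrix_(i < m, a < 3) ((a == (f i).1)%:R * v 0 (f i).2).
pose Q := \matrix_(r < 3, j < m) ((r == (g j).1)%:R * w 0 (g j).2).
have -> : koszul_mx (pure u v w) = P *m wedge_mx u *m Q.
  apply/matrixP => i j; rewrite -mulmxA !mxE.
  rewrite (bigD1 (f i).1) //= big1; last first.
    by move=> a /negPf a_neq; rewrite mxE a_neq !mul0r.
  rewrite addr0 !mxE (bigD1 (g j).1) //= big1; last first.
    by move=> r /negPf r_neq; rewrite !mxE r_neq mul0r mulr0.
  by rewrite !mxE ffunE !eqxx /=; ring.
by rewrite (leq_trans (mxrankM_maxl _ _)) // (leq_trans (mxrankM_maxr _ _))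
  ?rank_wedge_mx.
Qed.

Lemma koszul_det_eq0 (K : fieldType) n (T : tensor K 3 b c) :
  (2 * n < m)%N -> rank_le n T -> \det (koszul_mx T) = 0.
Proof.
move=> n_lt [u [v [w ->]]]; apply/eqP; rewrite -[_ == 0]negbK -unitfE -unitmxE.
rewrite -row_free_unit /row_free neq_ltn koszul_mx_sum.
apply/orP; left; apply: leq_ltn_trans n_lt.
have -> : (2 * n)%N = (\sum_(i < n) 2)%N.
  by rewrite sum_nat_const card_ord mulnC.
elim/big_ind2: _ => [|k A l B rkA rkB|i _]; last exact: rank_koszul_mx_pure.
  by rewrite mxrank0.
exact: leq_trans (mxrank_add _ _) (leq_add rkA rkB).
Qed.

(** The determinant of the flattening is a polynomial in the coordinates of the
    tensor, namely the determinant for the tensor of indeterminates. *)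
Lemma border_koszul_det_eq0 (K : fieldType) n (T : tensor K 3 b c) :
  (2 * n < m)%N -> border_rank_le n T -> \det (koszul_mx T) = 0.
Proof.
move=> n_lt; pose X (i : tensor_index 3 b c) :=
  'X_(enum_rank i) : {mpoly K[#|{: tensor_index 3 b c}|]}.
have evalE S : tensor_eval (\det (koszul_mx X)) S = \det (koszul_mx S).
  rewrite /tensor_eval -det_map_mx; congr (\det _).
  apply/matrixP => i j; rewrite !mxE rmorphM rmorphB !rmorph_nat.
  by rewrite /= mevalXU enum_rankK.
rewrite -evalE; apply: zariski_closure_eval => S /(koszul_det_eq0 n_lt).
by rewrite evalE.
Qed.

End Koszul.

Lemma perm3E (K : fieldType) i j k :
  perm3 K (i, j, k) = (uniq [:: i; j; k])%:R.
Proof.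
have pureE (s : 'S_3) : pure (delta_mx 0 (s 0)) (delta_mx 0 (s 1))
    (delta_mx 0 (s 2%:R)) (i, j, k) =
    ([&& s 0 == i, s 1 == j & s 2%:R == k])%:R :> K.
  rewrite ffunE !mxE /= ![_ == s _]eq_sym.
  by do 3!case: eqP => _; rewrite ?mulr0 ?mul0r ?mulr1.
have ord3P (h : 'I_3) : [\/ h = 0, h = 1 | h = 2%:R].
  case: h => -[|[|[|//]]] h_lt3; [apply: Or31|apply: Or32|apply: Or33];
  exact: val_inj.
rewrite sum_ffunE; under eq_bigr do rewrite pureE.
have [ijk_uniq|ijk_nuniq] := boolP (uniq _); last first.
  rewrite big1 // => s _; case: and3P => // -[/eqP si /eqP sj /eqP sk].
  by case/negP: ijk_nuniq; rewrite -si -sj -sk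
    (map_inj_uniq perm_inj [:: 0; 1; _]).
pose f (h : 'I_3) := nth i [:: i; j; k] h.
have f_inj : injective f.
  by move=> h h' /eqP; rewrite nth_uniq ?ltn_ord // => /eqP/val_inj.
rewrite (bigD1 (perm f_inj)) //= big1 ?permE ?eqxx ?addr0 // => s s_neq.
case: and3P => // -[/eqP si /eqP sj /eqP sk]; case/eqP: s_neq.
by apply/permP => h; rewrite permE; case: (ord3P h) => ->.
Qed.

Lemma perm3_rank_le4 (K : fieldType) :
  2%N \notin [pchar K] -> rank_le 4 (perm3 K).
Proof.
rewrite inE /= => two_neq0.
have four_neq0 : 4%:R != 0 :> K by rewrite (natrM K 2 2) mulf_neq0.
(* The two binary digits of n give the two signs. *)
pose x (n : 'I_4) : 'rV[K]_3 :=
  \row_i nth 1 [:: 1; (-1) ^+ n; (-1) ^+ n./2] i.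
exists (fun n : 'I_4 => ((-1) ^+ n * (-1) ^+ n./2 / 4%:R) *: x n), x, x.
apply/ffunP => -[[i j] k]; rewrite perm3E sum_ffunE !big_ord_recl big_ord0.
rewrite !ffunE !mxE /=.
by case: i j k => -[|[|[|//]]] ? [[|[|[|//]]] ?] [[|[|[|//]]] ?] /=; field.
Qed.

(** The basis vectors e_a (x) e_b with a != b are mapped to pairwise distinct
    basis vectors up to sign, and e_0 (x) e_0 to a sum that involves a new one;
    these seven rows and columns are listed so as to match. *)
Definition perm3_row (i : 'I_7) : 'I_3 * 'I_3 :=
  nth (0, 0) [:: (0, 0); (0, 1); (0, 2%:R); (1, 0); (1, 2%:R); (2%:R, 0);
                 (2%:R, 1)] i.

Definition perm3_col (i : 'I_7) : 'I_3 * 'I_3 :=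
  nth (0, 0) [:: (1, 1); (1, 0); (2%:R, 0); (0, 1); (2%:R, 1); (0, 2%:R);
                 (1, 2%:R)] i.

Lemma perm3_koszul (K : fieldType) :
  \det (koszul_mx perm3_row perm3_col (perm3 K)) != 0.
Proof.
rewrite det_trig.
  apply/prodf_neq0 => i _; rewrite mxE perm3E /levi_civita.
  case: i => -[|[|[|[|[|[|[|//]]]]]]] i_lt7 /=;
  by rewrite ?subr0 ?sub0r mulr1 ?oppr_eq0 oner_neq0.
apply/is_trig_mxP => i j; rewrite mxE perm3E /levi_civita.
case: i j => -[|[|[|[|[|[|[|//]]]]]]] i_lt7
  [[|[|[|[|[|[|[|//]]]]]]] j_lt7] //= _;
by rewrite ?mulr0 // subr0 mul0r.
Qed.

Theorem corollary1p14 (K : fieldType) (charK : 2%N \notin [pchar K]) :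
  brk (perm3 K) = 4%N /\ trk (perm3 K) = 4%N.
Proof.
have border_ge4 n : border_rank_le n (perm3 K) -> (4 <= n)%N.
  move=> border_n; rewrite leqNgt; apply/negP => n_lt4.
  case/eqP: (perm3_koszul K); apply: border_koszul_det_eq0 border_n.
  by rewrite (@leq_ltn_trans (2 * 3)) // leq_mul2l.
have rank4 := perm3_rank_le4 charK.
split; apply/eqP; rewrite eqn_leq; apply/andP; split.
- rewrite /brk; case: ex_minnP => n _; apply.
  by apply/asboolP; exact: rank_le_border rank4.
- rewrite /brk; case: ex_minnP => n /asboolP border_n _; exact: border_ge4.
- by rewrite /trk; case: ex_minnP => n _; apply; exact/asboolP.
- rewrite /trk; case: ex_minnP => n /asboolP rank_n _.
  by apply: border_ge4; exact: rank_le_border rank_n.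
Qed.
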